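(* Let $X$, $Y$, $Z$ be positive, absolutely continuous random variables with densities $f_X$, $f_Y$, $f_Z$, such that $X$ and $Y$ are independent and $Z \stackrel{d}{=} X/(X+Y)$ (so $Z$ takes values in $(0,1)$). Suppose that the density of $Y$ admits the decomposition $$f_Y(sx)=\mathbb{A}(s)\,\mathbb{B}(x)\,\mathbb{C}(sx),\qquad x,s>0,$$ for some positive real-valued functions $\mathbb{A},\mathbb{B},\mathbb{C}$ on $(0,\infty)$, where $$\mathbb{C}(x)=(1+\theta x)^{-p},\qquad x>0,$$ for some constants $\theta,p>0$. Then the density of $X$ is given, for $x>0$, by $$f_X(x)=\frac{1}{x\,\mathbb{B}(x)}\;\mathcal{G}_p^{-1}\left\{\frac{1}{s^{p}\,\mathbb{A}\!\left(\frac{1}{\theta s}\right)}\left(\frac{\theta s}{1+\theta s}\right)^2 f_Z\!\left(\frac{\theta s}{1+\theta s}\right)\right\}(x).$$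
   Context: For $p>0$, the generalized Stieltjes transform of a function $g$ on $(0,\infty)$ is $\mathcal{G}_p\{g\}(y)=\int_0^\infty g(x)\,(y+x)^{-p}\,\mathrm{d}x$, $y>0$; $\mathcal{G}_p^{-1}$ denotes its inverse, i.e. $\mathcal{G}_p^{-1}\{F\}$ is the function $g$ with $\mathcal{G}_p\{g\}=F$, and $\mathcal{G}_p^{-1}\{F\}(x)$ is this function evaluated at $x$. The notation $\stackrel{d}{=}$ means equality in distribution. *)

(* Defs.v *)
From HB Require Import structures.
From mathcomp Require Import all_boot all_order all_algebra.
From mathcomp Require Import all_classical all_reals all_analysis.
Set Implicit Arguments. Unset Strict Implicit. Unset Printing Implicit Defensive.
Import Order.TTheory GRing.Theory Num.Theory.
Local Open Scope classical_set_scope.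
Local Open Scope ring_scope.

Definition Gp (R : realType) (p : R) (g : R -> R) (y : R) : \bar R :=
  (\int[@lebesgue_measure R]_(x in `]0%R, +oo[) (g x * (y + x) `^ (- p))%:E)%E.

(* g is (a representative of) G_p^{-1}{F}: G_p{g} = F, the defining integral
   being absolutely convergent, for (Lebesgue-)almost every y > 0. *)
Definition is_Gp_inv (R : realType) (p : R) (F : R -> R) (g : R -> R) : Prop :=
  {ae @lebesgue_measure R, forall y : R, y \in `]0%R, +oo[ ->
     (@lebesgue_measure R).-integrable `]0%R, +oo[
        (fun x => (g x * (y + x) `^ (- p))%:E)
     /\ Gp p g y = (F y)%:E}.

Definition pos_density (d : measure_display) (T : measurableType d)
  (R : realType) (P : probability T R) (X : T -> R) (f : R -> R) : Prop :=
  measurable_fun setT f /\ (forall x, 0 < x -> 0 <= f x) /\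
  forall A : set R, measurable A ->
    P (X @^-1` A) = (\int[@lebesgue_measure R]_(x in A `&` `]0%R, +oo[) (f x)%:E)%E.

Definition indep_rv (d : measure_display) (T : measurableType d)
  (R : realType) (P : probability T R) (X Y : T -> R) : Prop :=
  forall A B : set R, measurable A -> measurable B ->
    P (X @^-1` A `&` Y @^-1` B) = (P (X @^-1` A) * P (Y @^-1` B))%E.

Definition eq_dist (d : measure_display) (T : measurableType d)
  (R : realType) (P : probability T R) (X Y : T -> R) : Prop :=
  forall A : set R, measurable A -> P (X @^-1` A) = P (Y @^-1` A).

(* Main.v *)
Require Import Defs.
From HB Require Import structures.
From mathcomp Require Import all_boot all_order all_algebra.
From mathcomp Require Import all_classical all_reals all_analysis.
From mathcomp Require Import measurable_realfun ring.
Set Implicit Arguments.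
Unset Strict Implicit.
Unset Printing Implicit Defensive.
Import Order.TTheory GRing.Theory Num.Theory.
Local Open Scope classical_set_scope.
Local Open Scope ring_scope.

(** The event [Z in A] is rewritten in two ways as an integral over the values
    [u = Y / X], using [Z = 1 / (1 + Y / X)] in law.  Substituting
    [z = 1 / (1 + u)] in the law of [Z] gives the density
    [fZ (1 / (1 + u)) / (1 + u)^2]; independence, the substitution [y = x u] and
    Tonelli give [\int x fX(x) fY(x u) dx].  The two densities thus agree for
    almost every [u > 0].  At [u = 1 / (theta y)] the decomposition of [fY] reads
    [fY(x u) = A(u) B(x) y^p (y + x)^-p], which turns that integral into
    [y^p A(u)] times the Stieltjes transform of [x B(x) fX(x)] at [y]; and
    the preimage of a null set under [y |-> 1 / (theta y)] is null. *)

(** * Measures given by a density *)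

(* The proofs are arguments so that the measure structure can be inferred. *)
Definition density_measure (d : measure_display) (T : measurableType d)
    (R : realType) (mu : {measure set T -> \bar R}) (D : set T)
    (mD : measurable D) (w : T -> R) (mw : measurable_fun D w)
    (w0 : forall x, D x -> 0 <= w x) (A : set T) : \bar R :=
  (\int[mu]_(x in A `&` D) (w x)%:E)%E.

Section density_measure.
Context (d : measure_display) (T : measurableType d) (R : realType).
Variables (mu : {measure set T -> \bar R}) (D : set T) (mD : measurable D).
Variables (w : T -> R) (mw : measurable_fun D w).
Hypothesis w0 : forall x, D x -> 0 <= w x.
Local Open Scope ereal_scope.

Local Notation nu := (density_measure mu mD mw w0).

Let nu0 : nu set0 = 0.
Proof. by rewrite /density_measure set0I integral_set0. Qed.

Let nu_ge0 A : 0 <= nu A.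
Proof. by apply: integral_ge0 => x [_ /w0]; rewrite lee_fin. Qed.

Let nu_sigma_additive : semi_sigma_additive nu.
Proof.
move=> /= A mA tA mUA.
rewrite /density_measure setI_bigcupl ge0_integral_bigcup//=.
- apply: is_cvg_ereal_nneg_natsum_cond => n _ _.
  by apply: integral_ge0 => /= x [_ /w0]; rewrite lee_fin.
- by move=> n; exact: measurableI.
- rewrite -setI_bigcupl; apply/measurable_EFinP.
  by apply: measurable_funS mw => //; exact: subIsetr.
- by move=> x [n _ [_ /w0]]; rewrite lee_fin.
- exact: trivIset_setIr.
Qed.

HB.instance Definition _ :=
  isMeasure.Build _ _ _ nu nu0 nu_ge0 nu_sigma_additive.

Import HBNNSimple.

(** Both sides are limits, by monotone convergence, of the integrals of an increasing sequence of
    simple functions; for a simple function the identity reduces by linearity to indicators, where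
    it is the definition of the density measure. *)
Lemma ge0_integral_density (E : set T) (f : T -> \bar R) : measurable E ->
  measurable_fun E f -> (forall x, E x -> 0 <= f x) ->
  \int[nu]_(x in E) f x = \int[mu]_(x in E `&` D) (f x * (w x)%:E).
Proof.
move=> mE mf f0.
have mED : measurable (E `&` D) by exact: measurableI.
have mwED : measurable_fun (E `&` D) (EFin \o w).
  by apply/measurable_EFinP; apply: measurable_funS mw => //; exact: subIsetr.
pose f_ := nnsfun_approx mE mf.
transitivity (limn (fun n => \int[nu]_(x in E) (f_ n x)%:E)).
  rewrite -monotone_convergence//.
  - apply: eq_integral => y /[!inE] yE; apply/esym/cvg_lim => //.
    exact: cvg_nnsfun_approx.
  - by move=> n; exact/measurable_EFinP/measurable_funP.
  - by move=> n y _; rewrite lee_fin.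
  - by move=> y _ m n mn; rewrite lee_fin; exact/lefP/nd_nnsfun_approx.
have mfw n : measurable_fun (E `&` D) (fun x => (f_ n x)%:E * (w x)%:E).
  by apply: emeasurable_funM => //; exact/measurable_EFinP/measurable_funP.
transitivity (limn (fun n => \int[mu]_(x in E `&` D) ((f_ n x)%:E * (w x)%:E))).
  apply: congr_lim; apply/funext => n.
  transitivity (\sum_(k \in range (f_ n))
      \int[mu]_(x in E `&` D) (k%:E * (\1_(f_ n @^-1` [set k]) x)%:E * (w x)%:E)).
    under eq_integral do rewrite fimfunE -fsumEFin//.
    rewrite ge0_integral_fsum//; last 2 first.
    - by move=> y; exact/measurable_EFinP/measurable_funM.
    - by move=> y x _; rewrite nnfun_muleindic_ge0.
    apply: eq_fsbigr => r _.
    (* A negative [r] is not a value of the nonnegative function [f_ n], so its level set is empty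
       and both terms vanish; pulling [r] out of the integrals is then only done for [r >= 0]. *)
    have [r0|r0] := ltP r 0%R.
      rewrite preimage_nnfun0// indic0.
      by rewrite !integral0_eq// => x _; rewrite ?mulr0// mule0 mul0e.
    rewrite integralZl_indic_nnsfun// integral_indic//=.
    under [RHS]eq_integral do rewrite -muleA.
    have mIw : measurable_fun (E `&` D)
        (fun x => (\1_(f_ n @^-1` [set r]) x)%:E * (w x)%:E).
      by apply: emeasurable_funM => //; exact/measurable_EFinP.
    rewrite ge0_integralZl//; last first.
      by move=> x [_ /w0 wx]; rewrite mule_ge0 ?lee_fin.
    congr (_ * _); rewrite /density_measure -setIA [LHS]integral_mkcondl.
    apply: eq_integral => x _; rewrite patchE indicE.
    by case: ifPn => _; rewrite ?mul1e ?mul0e.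
  rewrite -ge0_integral_fsum//.
  - apply: eq_integral => x; rewrite inE => -[_ Dx].
    rewrite -ge0_mule_fsuml; last by move=> r; rewrite nnfun_muleindic_ge0.
    by rewrite fimfunE -fsumEFin.
  - move=> r; apply: emeasurable_funM => //; apply: emeasurable_funM => //.
    exact/measurable_EFinP.
  - move=> r x [_ /w0 wx]; apply: mule_ge0; last by rewrite lee_fin.
    exact: nnfun_muleindic_ge0.
rewrite -monotone_convergence//.
- apply: eq_integral => x; rewrite inE => -[Ex Dx].
  apply/cvg_lim => //; apply: cvgeZr => //.
  exact: cvg_nnsfun_approx.
- by move=> n x [_ /w0 wx]; rewrite mule_ge0 ?lee_fin.
- move=> x [_ /w0 wx] m n mn; apply: lee_wpmul2r; rewrite ?lee_fin//.
  by exact/lefP/nd_nnsfun_approx.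
Qed.

End density_measure.

(** * Change of variables through images of measures *)

Section change_of_variables.
Import numFieldNormedType.Exports.
Local Open Scope ereal_scope.

(** Reduces a substitution to an equality between measures of sets: on subsets of [E], [nu] is the
    image under [phi] of the measure with density [w] on [D], so integrating against [nu] is
    integrating [f \o phi] against that density. *)
Lemma ge0_integral_pushforward_density (d1 d2 : measure_display)
    (S : measurableType d1) (T : measurableType d2) (R : realType)
    (mu : {measure set S -> \bar R}) (nu : {measure set T -> \bar R})
    (phi : S -> T) (w : S -> R) (D : set S) (E : set T) (f : T -> \bar R) :
  measurable_fun setT phi ->
  measurable D -> measurable_fun D w -> (forall x, D x -> 0 <= w x)%R ->
  measurable E ->
  (forall A, measurable A -> A `<=` E ->
    nu A = \int[mu]_(x in phi @^-1` A `&` D) (w x)%:E) ->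
  measurable_fun E f -> (forall x, E x -> 0 <= f x) ->
  \int[nu]_(y in E) f y =
  \int[mu]_(x in phi @^-1` E `&` D) (f (phi x) * (w x)%:E).
Proof.
move=> mphi mD mw w0 mE nuE mf f0.
have mphiE : measurable (phi @^-1` E).
  by rewrite -[X in measurable X]setTI; exact: mphi.
rewrite -(ge0_integral_density (f := f \o phi) mu mD mw w0 mphiE)//; first last.
- by move=> x /f0.
- apply: (measurable_comp mE _ mf); first by move=> _ [x ? <-].
  exact: measurable_funTS.
rewrite -(ge0_integral_pushforward mphi)//; last by move=> y /[!inE] /f0.
by apply: eq_measure_integral => A mA AE; rewrite nuE.
Qed.

Context {R : realType}.
Local Notation mu := (@lebesgue_measure R).

(** The image of [c dx] under the affine map gives each interval []s, t]] its length, and these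
    values characterize Lebesgue measure. *)
Lemma ge0_integration_by_substitution_affine (b c : R) (f : R -> \bar R) :
  (0 < c)%R -> measurable_fun `]b, +oo[ f ->
  (forall x, (b < x)%R -> 0 <= f x) ->
  \int[mu]_(x in `]b, +oo[) f x =
  \int[mu]_(x in `]0%R, +oo[) (f (b + c * x)%R * c%:E).
Proof.
move=> c0 mf f0.
pose phi : measurableTypeR R -> measurableTypeR R := fun x => (b + c * x)%R.
have mphi : measurable_fun setT phi.
  by apply: measurable_funD => //; exact: measurable_funM.
have mc : measurable_fun [set: R] (cst c) by [].
have c0' : forall x : R, [set: R] x -> (0 <= cst c x)%R by move=> ? _; exact: ltW.
have muE A : measurable A ->
    mu A = \int[mu]_(x in phi @^-1` A `&` setT) (cst c x)%:E.
  move=> mA.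
  pose m := pushforward (density_measure mu measurableT mc c0') phi.
  suff : mu A = m A by [].
  apply: lebesgue_measure_unique => //= _ [[s t] /= st <-].
  rewrite /m /pushforward /density_measure/= setIT.
  rewrite (_ : phi @^-1` _ = `](s - b) / c, (t - b) / c]%classic)%R; last first.
    apply/seteqP; split => x /=; rewrite !in_itv/= /phi;
    by rewrite ltr_pdivrMr// ler_pdivlMr// ltrBlDl lerBrDl [(x * c)%R]mulrC.
  rewrite integral_cst//= !lebesgue_measure_itv/= !lte_fin.
  rewrite ltr_pM2r ?invr_gt0// ltrD2r.
  case: ifPn => _; last by rewrite mule0.
  rewrite -!EFinB -EFinM -mulrBl mulrCA divff ?gt_eqF// mulr1; congr (_%:E).
  by rewrite opprB addrA subrK.
rewrite (@ge0_integral_pushforward_density _ _ _ _ _ mu _ phi (cst c) setT)//.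
- congr (integral _ _ _); rewrite setIT; apply/seteqP.
  by split => x /=; rewrite !in_itv/= !andbT /phi ltrDl pmulr_rgt0.
- by move=> A mA _; exact: muE.
- by move=> x /=; rewrite in_itv/= andbT => /f0.
Qed.

(** Inversion is continuous on the open set of nonzero reals; its value at 0 is 0 by convention, so
    the two pieces are glued. *)
Lemma measurable_invr : measurable_fun [set: R] (@GRing.inv R).
Proof.
pose f (x : R) := if x == 0%R then 0%R else x^-1%R.
rewrite (_ : GRing.inv = f); last first.
  by apply/funext => x; rewrite /f; case: eqP => [->|]; rewrite ?invr0.
apply: measurable_fun_if => //=.
- by apply: measurable_fun_eqr.
- rewrite setTI (_ : _ @^-1` _ = [set~ 0%R]); last first.
    by apply/seteqP; split => x /=; case: eqP.
  apply: open_continuous_measurable_fun.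
    by rewrite openC; exact: closed_eq.
  by move=> x /[!inE] /eqP x0; exact: inv_continuous.
Qed.

(** Fundamental theorem of calculus on a half-line with antiderivative [- x^-1], whose limit at
    infinity is 0. The value is the mass that the image of [x^-2 dx] under inversion gives to []0,
    t]]. *)
Lemma integral_invr2 (t : R) : (0 < t)%R ->
  \int[mu]_(x in `[t^-1%R, +oo[) ((x ^- 2)%R)%:E = t%:E.
Proof.
move=> t0; have tV0 : (0 < t^-1)%R by rewrite invr_gt0.
have dV (x : R) : (0 < x)%R -> is_derive x 1%R (fun x : R => - x^-1)%R (x ^- 2)%R.
  move=> x0; have x0' : id x != 0%R by rewrite gt_eqF.
  have := is_deriveN (@is_deriveV R id x 1%R 1%R x0' (is_derive_id x 1%R)).
  by move/is_derive_eq; apply; rewrite scaleNr opprK; exact: mulr1.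
have cV (x : R) : (0 < x)%R -> (- y^-1)%R @[y --> x] --> (- x^-1)%R.
  by move=> x0; apply: cvgN; apply: inv_continuous; rewrite gt_eqF.
have cV2 (x : R) : (0 < x)%R -> (y ^- 2)%R @[y --> x] --> (x ^- 2)%R.
  move=> x0; apply: cvgV; first by rewrite expf_neq0// gt_eqF.
  exact: exprn_continuous.
rewrite (@ge0_continuous_FTC2y R (fun x => x ^- 2)%R (fun x => - x^-1)%R _ 0)%R.
- by rewrite sub0e EFinN oppeK invrK.
- by move=> x _; rewrite invr_ge0 sqr_ge0.
- apply/(continuous_within_itvcyP _ (fun x : R => x ^- 2)%R); split.
    by move=> x; rewrite in_itv/= andbT => /(lt_trans tV0)/cV2.
  by apply: cvg_at_right_filter; exact: cV2.
- rewrite -[X in _ --> X]oppr0; apply: cvgN.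
  apply/(@gtr0_cvgV0 R R _ _ id); last exact: cvg_id.
  by exists 0%R; split.
- by move=> x /(lt_trans tV0)/dV[].
- by apply: cvg_at_right_filter; exact: cV.
- move=> x; rewrite in_itv/= andbT => /(lt_trans tV0)/dV.
  by move=> ?; rewrite derive1E derive_val.
Qed.

(** The image of [x^-2 dx] on the positive half-line under inversion gives mass [t] to each []0,
    t]], hence agrees there with Lebesgue measure. *)
Lemma ge0_integration_by_substitution_inv (f : R -> \bar R) :
  measurable_fun `](0%R : R), +oo[ f -> (forall x : R, (0 < x)%R -> 0 <= f x) ->
  \int[mu]_(x in `]0%R, +oo[) f x =
  \int[mu]_(x in `]0%R, +oo[) (f (x^-1)%R * ((x ^- 2)%R)%:E).
Proof.
move=> mf f0; pose D : set R := `]0%R, +oo[%classic.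
have mD : measurable D by exact: measurable_itv.
have mDC : measurable (~` D) by exact: measurableC.
pose phi : measurableTypeR R -> measurableTypeR R := @GRing.inv R.
have mphi : measurable_fun setT phi by exact: measurable_invr.
pose w (x : R) : R := (x ^- 2)%R.
have mw : measurable_fun D w.
  by apply: measurable_funTS; apply: measurableT_comp => //; exact: exprn_measurable.
have w0 x : D x -> (0 <= w x)%R by move=> _; rewrite invr_ge0 sqr_ge0.
have phiDE : phi @^-1` D `&` D = D.
  apply/seteqP; split => [x []//|x Dx]; split => //.
  by move: Dx; rewrite /D /phi /= !in_itv/= !andbT invr_gt0.
pose m1 := density_measure mu mD mw w0.
pose K := pushforward m1 phi.
have K0 (t : R) : (0 < t)%R -> K `]0%R, t]%classic = t%:E.
  move=> t0; rewrite -(integral_invr2 t0) /K /pushforward /m1 /density_measure.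
  congr (integral _ _ _); apply/seteqP; split => x;
    rewrite /D /phi /= !in_itv/= !andbT.
    by move=> [/andP[_ xt] x0]; rewrite -[leRHS]invrK lef_pV2// posrE ?invr_gt0.
  move=> tx; have x0 : (0 < x)%R by apply: lt_le_trans tx; rewrite invr_gt0.
  by rewrite invr_gt0 x0 -[leRHS]invrK lef_pV2// ?posrE ?invr_gt0.
have KD A : A `<=` ~` D -> K A = 0.
  move=> AD; rewrite /K /pushforward /m1 /density_measure /D.
  rewrite (_ : _ `&` _ = set0) ?integral_set0//.
  rewrite -subset0 => x [/AD phiDx Dx]; apply: phiDx.
  by have [] : (phi @^-1` D `&` D) x by rewrite phiDE.
(* [lebesgue_measure_unique] compares measures on the whole line, so the image
   [K] of [u^-2 du] is completed by Lebesgue measure on the complement of [D]. *)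
have muE A : measurable A -> mu A = measure_add (mrestr mu mDC) K A.
  apply: lebesgue_measure_unique => // _ [[s t] /= _ <-].
  transitivity (mrestr mu mDC `]s, t]%classic + K `]s, t]%classic); last first.
    by rewrite -measure_addE.
  rewrite /mrestr.
  have [st|ts] := leP s t; last first.
    by rewrite set_itv_ge ?bnd_simp -?leNgt 1?ltW// set0I measure0 KD ?adde0.
  have [t0|t0] := leP t 0%R.
    have stD : `]s, t]%classic `<=` ~` D.
      move=> x /=; rewrite /D /= !in_itv/= andbT => /andP[_ xt].
      by apply/negP; rewrite -leNgt (le_trans xt).
    by rewrite KD// adde0; congr (mu _); apply/esym/setIidPl.
  have splitK (u v : R) : (u <= v)%R -> (v <= t)%R ->
      K `]u, t]%classic = K `]u, v]%classic + K `]v, t]%classic.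
    move=> uv vt.
    have -> : `]u, t]%classic = `]u, v]%classic `|` `]v, t]%classic.
      by rewrite -itv_bndbnd_setU// bnd_simp.
    have := @measureU _ _ _ [the measure _ _ of pushforward m1 phi].
    apply => //; apply/seteqP; split => x //= []; rewrite !in_itv/=.
    by move=> /andP[_ +] /andP[+ _]; rewrite leNgt => /negbTE ->.
  have [s0|s0] := leP s 0%R.
    rewrite (_ : _ `&` _ = `]s, 0%R]%classic); last first.
      apply/seteqP; split => x; rewrite /D /= !in_itv/= andbT.
        by move=> [/andP[-> _] /negP]; rewrite -leNgt.
      move=> /andP[-> x0]; split; first exact: le_trans (ltW t0).
      by apply/negP; rewrite -leNgt.
    rewrite (splitK s 0%R)// ?ltW// KD ?add0e ?K0//; last first.
      move=> x; rewrite /D /= !in_itv/= andbT => /andP[_].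
      by rewrite leNgt => /negP.
    rewrite !lebesgue_measure_itv/= !lte_fin (le_lt_trans s0 t0).
    move: s0; rewrite le_eqVlt => /predU1P[->|s0].
      by rewrite ltxx sube0 add0e.
    by rewrite s0 -!EFinB -EFinD sub0r addrC.
  rewrite (_ : _ `&` _ = set0) ?measure0 ?add0e; last first.
    rewrite -subset0 => x; rewrite /D /= !in_itv/= andbT.
    by move=> [/andP[sx _]]; apply; exact: lt_trans sx.
  (* [K] of []s, t]] is found as the difference of the finite masses [t] and [s] of []0, t]] and
     []0, s]]. *)
  have := splitK 0%R s (ltW s0) st; rewrite !K0// => tE.
  rewrite lebesgue_measure_itv/= lte_fin.
  have -> : K `]s, t]%classic = (t - s)%:E.
    by rewrite EFinB tE addeAC subee ?add0e.
  move: st; rewrite le_eqVlt => /predU1P[->|->//].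
  by rewrite ltxx subrr.
rewrite (@ge0_integral_pushforward_density _ _ _ _ _ mu _ phi w D)//.
- by congr (integral _ _ _); exact: phiDE.
(* For [A] inside [D] the part of the measure carried by the complement of [D] vanishes, which
   leaves [K]. *)
- move=> A mA AD; transitivity (mrestr mu mDC A + K A).
    by rewrite -measure_addE; exact: muE.
  rewrite /mrestr.
  rewrite (_ : A `&` _ = set0) ?measure0 ?add0e//.
  by apply/disjoints_subset; rewrite setCK.
- by move=> x /=; rewrite in_itv/= andbT => /f0.
Qed.

End change_of_variables.

(** * Scaling, and the map [x |-> 1 / (1 + x)] from the half-line to the unit interval *)

Section substitutions_on_positive_reals.
Context {R : realType}.
Local Notation mu := (@lebesgue_measure R).
Local Open Scope ereal_scope.

Lemma ge0_integration_by_substitution_scale (c : R) (f : R -> \bar R) :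
  (0 < c)%R -> measurable_fun `](0 : R)%R, +oo[ f ->
  (forall x : R, (0 < x)%R -> 0 <= f x) ->
  \int[mu]_(x in `]0%R, +oo[) f x =
  \int[mu]_(x in `]0%R, +oo[) (f (c * x)%R * c%:E).
Proof.
move=> c0 mf f0; rewrite (ge0_integration_by_substitution_affine c0 mf f0).
by apply: eq_integral => x _; rewrite add0r.
Qed.

(** Composition of two substitutions: inversion carries []0, 1[] to []1, +oo[], and translation by 1
    brings that back to []0, +oo[]. *)
Lemma ge0_integration_by_substitution_inv1D (f : R -> \bar R) :
  measurable_fun setT f -> (forall x : R, (0 < x < 1)%R -> 0 <= f x) ->
  \int[mu]_(x in `]0%R, 1%R[) f x =
  \int[mu]_(x in `]0%R, +oo[) (f ((1 + x)^-1)%R * (((1 + x) ^- 2)%R)%:E).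
Proof.
move=> mf f0.
have setI01 : (`]0%R, +oo[ `&` `]0%R, 1%R[ = `]0%R, 1%R[ :> set R)%classic.
  by apply/setIidPr => x /=; rewrite !in_itv/= andbT => /andP[].
have setI1y : (`]0%R, +oo[ `&` `]1%R, +oo[ = `]1%R, +oo[ :> set R)%classic.
  by apply/setIidPr => x /=; rewrite !in_itv/= !andbT; exact: lt_trans.
(* Extending [f] by zero off []0, 1[] puts the integral on the whole half-line, where inversion
   applies. *)
rewrite -setI01 integral_mkcondr.
rewrite (ge0_integration_by_substitution_inv
  (f := f \_ `]0%R, 1%R[)); last 2 first.
- apply: measurable_funTS.
  by apply/(measurable_restrictT _ _).1 => //; exact: measurable_funTS.
- move=> x x0; rewrite patchE; case: ifPn => //.
  by rewrite inE/= in_itv/= => /f0.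
transitivity (\int[mu]_(x in `]1%R, +oo[) (f (x^-1)%R * ((x ^- 2)%R)%:E)).
  rewrite -setI1y integral_mkcondr; apply: eq_integral => x.
  rewrite inE/= in_itv/= andbT => x0; rewrite !patchE !mem_setE !in_itv/= andbT.
  by rewrite invr_gt0 x0 invf_lt1//=; case: ifPn => // _; rewrite mul0e.
have mg : measurable_fun [set: R] (fun x : R => f (x^-1)%R * ((x ^- 2)%R)%:E).
  apply: emeasurable_funM.
    by apply: (measurableT_comp mf); exact: measurable_invr.
  apply/measurable_EFinP/measurableT_comp; first exact: measurable_invr.
  exact: exprn_measurable.
rewrite (ge0_integration_by_substitution_affine (c := 1%R))//.
- by apply: eq_integral => x _; rewrite mul1r mule1.
- exact: measurable_funTS.
- move=> x x1; have x0 := lt_trans ltr01 x1; rewrite mule_ge0//.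
    by apply: f0; rewrite invr_gt0 x0 invf_lt1.
  by rewrite lee_fin invr_ge0 sqr_ge0.
Qed.

End substitutions_on_positive_reals.

(** * Tonelli's theorem on a measurable rectangle *)

Section tonelli_on_rectangles.
Local Open Scope ereal_scope.
Context (d1 d2 : measure_display) (T1 : measurableType d1)
  (T2 : measurableType d2) (R : realType).
Variables (m1 : {sigma_finite_measure set T1 -> \bar R})
  (m2 : {sigma_finite_measure set T2 -> \bar R}).
Variables (D : set T1) (E : set T2) (f : T1 * T2 -> \bar R).
Hypotheses (mD : measurable D) (mE : measurable E).
Hypothesis mf : measurable_fun (D `*` E) f.
Hypothesis f0 : forall x y, D x -> E y -> 0 <= f (x, y).

(** The extension by zero is measurable and nonnegative on the whole product, so the global Tonelli
    theorem applies to it; its partial integrals are the extensions by zero of those of [f]. *)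
Let g := f \_ (D `*` E).

Let mg : measurable_fun setT g.
Proof. by apply/(measurable_restrictT _ _).1 => //; exact: measurableX. Qed.

Let g0 z : 0 <= g z.
Proof.
by rewrite /g patchE; case: ifPn => //; case: z => x y /[!inE] -[]; exact: f0.
Qed.

Let g_in x y : D x -> g (x, y) = ((fun y => f (x, y)) \_ E) y.
Proof. by move=> Dx; rewrite /g !patchE in_setX/= mem_set. Qed.

Let g_notin x y : ~ D x -> g (x, y) = 0.
Proof. by move=> Dx; rewrite /g patchE in_setX/= memNset. Qed.

Let integral_gl x :
  \int[m2]_y g (x, y) = ((fun x => \int[m2]_(y in E) f (x, y)) \_ D) x.
Proof.
rewrite patchE; case: ifPn; rewrite ?(inE, notin_setE) => Dx.
  by rewrite [RHS]integral_mkcond; apply: eq_integral => y _; exact: g_in.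
by apply: integral0_eq => y _; exact: g_notin.
Qed.

Let integral_gr y :
  \int[m1]_x g (x, y) = ((fun y => \int[m1]_(x in D) f (x, y)) \_ E) y.
Proof.
rewrite patchE; case: ifPn => Ey.
  rewrite [RHS]integral_mkcond; apply: eq_integral => x _.
  by rewrite /g !patchE in_setX/= Ey andbT.
by apply: integral0_eq => x _; rewrite /g patchE in_setX/= (negbTE Ey) andbF.
Qed.

Lemma ge0_integral_rectangleC :
  \int[m1]_(x in D) \int[m2]_(y in E) f (x, y) =
  \int[m2]_(y in E) \int[m1]_(x in D) f (x, y).
Proof.
rewrite integral_mkcond [RHS]integral_mkcond.
under eq_integral do rewrite -integral_gl.
under [RHS]eq_integral do rewrite -integral_gr.
exact: fubini_tonelli.
Qed.

Lemma measurable_integral_rectangle :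
  measurable_fun E (fun y => \int[m1]_(x in D) f (x, y)).
Proof.
apply/(measurable_restrictT _ mE).
have := @measurable_fun_fubini_tonelli_G _ _ _ _ _ m1 g mg g0.
by apply: eq_measurable_fun => y _; rewrite -integral_gr.
Qed.

End tonelli_on_rectangles.

(** * Two expressions for the density of [Y / X] *)

Section ratio_density.
Context (d : measure_display) (T : measurableType d) (R : realType)
  (P : probability T R).
Local Notation mu := (@lebesgue_measure R).
Local Open Scope ereal_scope.

(** By independence the law of the pair agrees with the product of the marginal laws on rectangles,
    hence on all measurable sets; it is then integrated section by section. *)
Lemma joint_law_indep (X Y : T -> R) (fX fY : R -> R) (S : set (R * R)) :
  measurable_fun setT X -> measurable_fun setT Y ->
  pos_density P X fX -> pos_density P Y fY -> indep_rv P X Y -> measurable S ->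
  P [set w | S (X w, Y w)] =
  \int[mu]_(x in `]0%R, +oo[)
    \int[mu]_(y in [set y | S (x, y)] `&` `]0%R, +oo[) (fX x * fY y)%:E.
Proof.
move=> mX mY [mfX [fX0 XE]] [mfY [fY0 YE]] XY mS.
pose D : set R := `]0%R, +oo[%classic.
have mD : measurable D by exact: measurable_itv.
pose rX : {RV P >-> R} := mfun_Sub (mem_set mX).
pose rY : {RV P >-> R} := mfun_Sub (mem_set mY).
have mXY := measurable_fun_pair mX mY.
have -> : P [set w | S (X w, Y w)] = (distribution P rX \x distribution P rY) S.
  suff -> : (distribution P rX \x distribution P rY) S =
    pushforward P (fun w => (X w, Y w)) S by [].
  exact: product_measure_unique.
rewrite /product_measure1 /=.
have xsE x : xsection S x = [set y | S (x, y)].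
  by apply/seteqP; split => y /=; rewrite /xsection/= inE.
have mxs x : measurable [set y | S (x, y)].
  by rewrite -xsE; exact: measurable_xsection.
(* Taking the identity for [phi] replaces the law of [X] by its density [fX]. *)
transitivity (\int[mu]_(x in id @^-1` setT `&` D)
    ((distribution P rY \o xsection S) (id x) * (fX x)%:E)).
  apply: ge0_integral_pushforward_density => //.
  - exact: measurable_funTS.
  - by move=> x; rewrite /D /= in_itv/= andbT => /fX0.
  - by move=> A mA _; exact: XE.
  - exact: measurable_fun_xsection.
rewrite setTI; apply: eq_integral => x; rewrite inE /D /= in_itv/= andbT => x0.
rewrite /distribution /pushforward xsE YE// muleC.
rewrite -ge0_integralZl//.
- apply: measurableI.
    by apply: mxs.
  exact: mD.
- by apply/measurable_EFinP; exact: measurable_funTS.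
- by move=> y [_ /=]; rewrite in_itv/= andbT lee_fin => /fY0.
- by rewrite lee_fin fX0.
Qed.

(** Over every measurable [E] of positive reals, both functions integrate to the probability that
    [0 < Z < 1] and [Z^-1 - 1] lies in [E]; equality of all these integrals forces equality almost
    everywhere. *)
Lemma ae_eq_density_ratio (X Y Z : T -> R) (fX fY fZ : R -> R) :
  measurable_fun setT X -> measurable_fun setT Y -> measurable_fun setT Z ->
  pos_density P X fX -> pos_density P Y fY -> pos_density P Z fZ ->
  indep_rv P X Y ->
  eq_dist P Z (fun w => X w / (X w + Y w))%R ->
  ae_eq mu `]0%R, +oo[%classic
    (fun u => (fZ (1 + u)^-1 * (1 + u) ^- 2)%:E)
    (fun u => \int[mu]_(x in `]0%R, +oo[) (x * fX x * fY (x * u))%:E).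
Proof.
move=> mX mY mZ dX dY [mfZ [fZ0 ZE]] XY ZXY.
have [[mfX [fX0 _]] [mfY [fY0 _]]] := (dX, dY).
pose D : set R := `]0%R, +oo[%classic.
have mD : measurable D by exact: measurable_itv.
have posD x : D x -> (0 < x)%R by rewrite /D/= in_itv/= andbT.
pose g (u : R) := (fZ (1 + u)^-1 * (1 + u) ^- 2)%R.
have g0 u : D u -> (0 <= g u)%R.
  move=> /posD u0; rewrite /g mulr_ge0 ?invr_ge0 ?sqr_ge0//.
  by apply: fZ0; rewrite invr_gt0 addr_gt0.
have m1D : measurable_fun setT (fun u : R => 1 + u)%R by exact: measurable_funD.
have mg : measurable_fun setT g.
  apply: measurable_funM.
    apply: (measurableT_comp mfZ).
    by apply: (measurableT_comp (@measurable_invr R)).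
  apply: (measurableT_comp (@measurable_invr R)).
  exact: measurable_funX.
pose q (xu : R * R) : \bar R := (xu.1 * fX xu.1 * fY (xu.1 * xu.2))%:E.
have mq : measurable_fun setT q.
  apply/measurable_EFinP; apply: measurable_funM.
    by apply: measurable_funM => //; exact: measurableT_comp.
  apply: (measurableT_comp mfY).
  exact: measurable_funM.
have q0 x u : D x -> D u -> 0 <= q (x, u).
  move=> /posD x0 /posD u0; rewrite /q/= lee_fin !mulr_ge0//; first exact: ltW.
    exact: fX0.
  by apply: fY0; rewrite mulr_gt0.
(* Inverse of [u |-> 1 / (1 + u)]: it sends [x / (x + y)] to [y / x]. *)
pose psi (z : R) : R := (z^-1 - 1)%R.
have mpsi : measurable_fun setT psi.
  by apply: measurable_funB => //; exact: measurable_invr.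
(* First computation, from the density of [Z] and [z = 1 / (1 + u)]. *)
have gE E : E `<=` D -> measurable E ->
    \int[mu]_(u in E) (g u)%:E = P (Z @^-1` (`]0%R, 1%R[ `&` psi @^-1` E)).
  move=> ED mE; have DE : D `&` E = E by exact/setIidPr.
  have mpE : measurable (psi @^-1` E).
    by rewrite -[X in measurable X]setTI; exact: mpsi.
  have m01 : measurable (`]0%R, 1%R[ : set R) by exact: measurable_itv.
  rewrite ZE; last exact: measurableI.
  rewrite (_ : _ `&` _ `&` _ = `]0%R, 1%R[ `&` psi @^-1` E); last first.
    apply/seteqP; split => [x [//]|x [x01 xE]]; split => //.
    by move: x01; rewrite /= !in_itv/= andbT => /andP[].
  rewrite integral_mkcondr.
  rewrite (ge0_integration_by_substitution_inv1D
    (f := (EFin \o fZ) \_ (psi @^-1` E))); last 2 first.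
  - apply/(measurable_restrictT _ _).1 => //.
    by apply/measurable_EFinP; exact: measurable_funTS.
  - move=> x /andP[x0 _]; rewrite patchE; case: ifPn => // _.
    by rewrite lee_fin fZ0.
  rewrite -[in LHS]DE integral_mkcondr; apply: eq_integral => u.
  rewrite inE => /posD u0; rewrite !patchE.
  have -> : (1 + u)^-1%R \in psi @^-1` E = (u \in E).
    by apply/idP/idP; rewrite !inE /psi /= invrK addrAC subrr add0r.
  by case: ifPn => // _; rewrite mul0e.
(* Second computation, from the joint law of [X] and [Y], Tonelli and [y = x u] at fixed [x]. *)
have hE E : E `<=` D -> measurable E ->
    \int[mu]_(u in E) \int[mu]_(x in D) q (x, u) =
    P (Z @^-1` (`]0%R, 1%R[ `&` psi @^-1` E)).
  move=> ED mE; have DE : D `&` E = E by exact/setIidPr.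
  have mpE : measurable (psi @^-1` E).
    by rewrite -[X in measurable X]setTI; exact: mpsi.
  have m01 : measurable (`]0%R, 1%R[ : set R) by exact: measurable_itv.
  have mA : measurable (`]0%R, 1%R[ `&` psi @^-1` E : set R) by exact: measurableI.
  pose r (xy : R * R) : R := (xy.1 / (xy.1 + xy.2))%R.
  have mr : measurable_fun setT r.
    apply: measurable_funM => //.
    apply: (measurableT_comp (@measurable_invr R)).
    exact: measurable_funD.
  pose S : set (R * R) := r @^-1` (`]0%R, 1%R[ `&` psi @^-1` E).
  have mS : measurable S by rewrite -[X in measurable X]setTI; exact: mr.
  rewrite (ZXY _ mA); transitivity (P [set w | S (X w, Y w)]); last by [].
  rewrite (joint_law_indep mX mY dX dY XY mS).
  transitivity (\int[mu]_(x in D) \int[mu]_(u in E) q (x, u)).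
    apply/esym/ge0_integral_rectangleC => //; first exact: measurable_funTS.
    by move=> x u Dx /ED; exact: q0.
  apply: eq_integral => x; rewrite inE => /posD x0.
  have mEx : measurable [set y | E (y / x)%R].
    have mdivx : measurable_fun setT (fun y : R => y / x)%R.
      exact: measurable_funM.
    by rewrite -[X in measurable X]setTI; exact: mdivx.
  (* For positive [x] and [y] the ratio [r (x, y)] always lies in []0, 1[], so the event only says
     that [y / x] is in [E]. *)
  rewrite (_ : _ `&` _ = D `&` [set y | E (y / x)%R]); last first.
    rewrite setIC; apply/seteqP; split => y [/[dup] Dy /posD y0];
      have xy0 : (0 < x + y)%R by [exact: addr_gt0];
      have psir : psi (r (x, y)) = (y / x)%R by
        rewrite /psi /r/= invf_div mulrDl divff ?gt_eqF// addrAC subrr add0r.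
      by move=> [_ /=]; rewrite psir.
    move=> Ey; split => //; split; last by rewrite /= psir.
    by rewrite /r /= in_itv/= divr_gt0//= ltr_pdivrMr// mul1r ltrDl.
  rewrite integral_mkcondr.
  rewrite (ge0_integration_by_substitution_scale x0); last 2 first.
  - apply: measurable_funTS; apply/(measurable_restrictT _ _).1 => //.
    by apply/measurable_EFinP; apply: measurable_funTS; exact: measurable_funM.
  - move=> y y0; rewrite patchE; case: ifPn => // _.
    by rewrite lee_fin mulr_ge0 ?fX0 ?fY0.
  rewrite -[in LHS]DE integral_mkcondr; apply: eq_integral => u.
  rewrite inE => /posD u0; rewrite !patchE.
  have -> : (x * u)%R \in [set y | E (y / x)%R] = (u \in E).
    by apply/idP/idP; rewrite !inE /= mulrAC divff ?mul1r ?gt_eqF.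
  case: ifPn => // _; last by rewrite mul0e.
  by rewrite /q/= -EFinM -mulrA [in RHS]mulrC.
(* The integrability of [g] comes from [gE] at [D]: its integral is a probability. *)
apply: integral_ae_eq => //.
- apply/integrableP; split.
    by apply/measurable_EFinP; exact: measurable_funTS.
  have gabs : \int[mu]_(u in D) `|(g u)%:E| = \int[mu]_(u in D) (g u)%:E.
    by apply: eq_integral => u; rewrite inE => Du; rewrite gee0_abs// lee_fin g0.
  suff : \int[mu]_(u in D) `|(g u)%:E| < +oo by [].
  rewrite gabs gE//; apply: (le_lt_trans (probability_le1 P _)); last exact: ltry.
  rewrite -[X in measurable X]setTI; apply: mZ => //; apply: measurableI => //.
  by rewrite -[X in measurable X]setTI; exact: mpsi.
- have mqDD : measurable_fun (D `*` D) q by exact: measurable_funTS.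
  exact: (measurable_integral_rectangle mu mD mD mqDD q0).
- by move=> E ED mE; rewrite gE// -hE.
Qed.
End ratio_density.

(** * Null sets under the change of parameter [u = 1 / (theta y)] *)

(** The indicator of an exceptional null set has integral zero; after substitution it carries a
    strictly positive Jacobian, so the pulled-back indicator vanishes almost everywhere. *)
Lemma ae_invr_scale (R : realType) (theta : R) (Q : R -> Prop) : 0 < theta ->
  {ae @lebesgue_measure R, forall u : R, 0 < u -> Q u} ->
  {ae @lebesgue_measure R, forall y : R, 0 < y -> Q (theta * y)^-1}.
Proof.
move=> theta0 [N [mN N0 QN]].
pose D : set R := `]0%R, +oo[%classic.
have mD : measurable D by exact: measurable_itv.
have mI : measurable_fun setT (fun x : R => (\1_N x : R)%:E).
  by apply/measurable_EFinP; exact: measurable_indic.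
have mInv : measurable_fun setT (fun x : R => (\1_N x^-1 : R)%:E).
  exact: (measurableT_comp mI (@measurable_invr R)).
have mInv2 : measurable_fun setT
    (fun x : R => ((\1_N x^-1 : R)%:E * (x ^- 2)%:E)%E).
  apply: emeasurable_funM => //; apply/measurable_EFinP.
  apply: (measurableT_comp (@measurable_invr R)).
  exact: exprn_measurable.
(* Indicator of [N] at [(theta * y)^-1] times the Jacobian: the inverse square comes from the
   inversion, the factor [theta] from the scaling. *)
pose G (y : R) := ((\1_N (theta * y)^-1)%:E * ((theta * y) ^- 2)%:E * theta%:E)%E.
have mG : measurable_fun setT G.
  apply: emeasurable_funM => //.
  apply: (measurableT_comp mInv2).
  exact: measurable_funM.
have G0 y : (0 <= G y)%E.
  by rewrite /G !mule_ge0// lee_fin ?invr_ge0 ?sqr_ge0 ?ltW.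
have intG : (\int[@lebesgue_measure R]_(y in D) G y = 0)%E.
  rewrite -(ge0_integration_by_substitution_scale
    (f := fun x => ((\1_N x^-1)%:E * (x ^- 2)%:E)%E) theta0)//; last 2 first.
  - exact: measurable_funTS.
  - by move=> x _; rewrite mule_ge0// lee_fin invr_ge0 sqr_ge0.
  rewrite -(ge0_integration_by_substitution_inv
    (f := fun x => (\1_N x)%:E))//; last first.
    exact: measurable_funTS.
  rewrite integral_indic//; apply/eqP; rewrite eq_le measure_ge0 andbT.
  rewrite -N0; apply: le_measure; rewrite ?inE//; exact: measurableI.
have /ae_eq_integral_abs : (\int[@lebesgue_measure R]_(y in D) `|G y| = 0)%E.
  by rewrite -[RHS]intG; apply: eq_integral => y _; rewrite gee0_abs.
move=> /(_ mD (measurable_funTS mG)); apply: filterS => y Gy y0.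
have {}Gy : G y = 0%E by apply: Gy; rewrite /D /= in_itv/= y0.
apply: contrapT => nQ; move: Gy.
have ty0 : 0 < theta * y by exact: mulr_gt0.
have NQ : N (theta * y)^-1.
  by apply: QN => /=; apply/not_implyP; split => //; rewrite invr_gt0.
rewrite /G indicE mem_set// mul1e -EFinM => -[] /eqP.
by rewrite gt_eqF// mulr_gt0// invr_gt0 exprn_gt0.
Qed.

(** * Identification of the generalized Stieltjes transform *)

Unset Implicit Arguments.

Theorem theorem3 (d : measure_display) (T : measurableType d) (R : realType)
  (P : probability T R) (X Y Z : T -> R) (fX fY fZ : R -> R)
  (A B C : R -> R) (theta p : R) :
  measurable_fun setT X -> measurable_fun setT Y -> measurable_fun setT Z ->
  pos_density P X fX -> pos_density P Y fY -> pos_density P Z fZ ->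
  indep_rv P X Y ->
  eq_dist P Z (fun w => X w / (X w + Y w)) ->
  0 < theta -> 0 < p ->
  (forall x, 0 < x -> 0 < A x) ->
  (forall x, 0 < x -> 0 < B x) ->
  (forall x, 0 < x -> 0 < C x) ->
  (forall x s, 0 < x -> 0 < s -> fY (s * x) = A s * B x * C (s * x)) ->
  (forall x, 0 < x -> C x = (1 + theta * x) `^ (- p)) ->
  is_Gp_inv p
    (fun s => (s `^ p * A (1 / (theta * s)))^-1
              * (theta * s / (1 + theta * s)) ^+ 2
              * fZ (theta * s / (1 + theta * s)))
    (fun x => x * B x * fX x).
Proof.
move=> mX mY mZ dX dY dZ XY ZXY theta0 p0 A0 B0 _ fYE CE.
have [[mfX _] [mfY _]] := (dX, dY).
pose D : set R := `]0%R, +oo[%classic.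
have mD : measurable D by exact: measurable_itv.
pose q (u x : R) := x * fX x * fY (x * u).
have /(ae_invr_scale theta0) : {ae @lebesgue_measure R, forall u : R, 0 < u ->
    ((fZ (1 + u)^-1 * (1 + u) ^- 2)%:E
     = \int[@lebesgue_measure R]_(x in D) (q u x)%:E)%E}.
  have := ae_eq_density_ratio mX mY mZ dX dY dZ XY ZXY.
  by apply: filterS => u + u0; apply; rewrite /= in_itv/= u0.
apply: filterS; first exact: (ae_filter_ringOfSetsType (@lebesgue_measure R)).
move=> y + /[!in_itv]/= /[!andbT] y0 => /(_ y0).
set u := (theta * y)^-1 => int_q.
have ty0 : 0 < theta * y by exact: mulr_gt0.
have u0 : 0 < u by rewrite invr_gt0.
have mq : measurable_fun D (EFin \o q u).
  apply/measurable_EFinP/measurable_funTS/measurable_funM.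
    exact: measurable_funM.
  by apply: (measurableT_comp mfY); exact: measurable_funM.
have q_ge0 x : D x -> 0 <= q u x.
  rewrite /D /= in_itv/= andbT => x0.
  have [_ [fX0 _]] := dX; have [_ [fY0 _]] := dY.
  by rewrite /q !mulr_ge0// ?fX0 ?fY0 ?mulr_gt0// ltW.
(* [int_q] equates the integral of the nonnegative [q u] with a real number, so it is finite; this
   gives the absolute convergence required by [is_Gp_inv]. *)
have iq : (@lebesgue_measure R).-integrable D (EFin \o q u).
  apply/integrableP; split => //.
  have qabs : (\int[@lebesgue_measure R]_(x in D) `|(q u x)%:E|
      = \int[@lebesgue_measure R]_(x in D) (q u x)%:E)%E.
    by apply: eq_integral => x /[!inE] Dx; rewrite gee0_abs// lee_fin q_ge0.
  suff : (\int[@lebesgue_measure R]_(x in D) `|(q u x)%:E| < +oo)%E by [].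
  by rewrite qabs -int_q ltry.
(* The factor, independent of [x], that turns [fY (x * u)] into [B x] times the Stieltjes kernel. *)
pose K := (y `^ p * A u)^-1.
have kernelE x : D x -> x * B x * fX x * (y + x) `^ (- p) = K * q u x.
  rewrite /D /= in_itv/= andbT => x0.
  have yp0 : y `^ p != 0 by rewrite gt_eqF// powR_gt0.
  have Au0 : A u != 0 by rewrite gt_eqF// A0.
  (* Since [theta * u = 1 / y], [C (u * x)] is [(1 + x / y)] to the power [- p]; multiplying the
     bases [y] and [1 + x / y] gives [y + x]. *)
  have -> : (y + x) `^ (- p) = (y `^ p)^-1 * C (u * x).
    rewrite CE ?mulr_gt0// -powRN -powRM ?ltW ?addr_gt0 ?mulr_gt0//.
    congr (_ `^ _); rewrite mulrDr mulr1; congr (_ + _).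
    rewrite /u invfM; field; rewrite ?gt_eqF//.
  rewrite /q [x * u]mulrC fYE// /K; field.
  by rewrite Au0 yp0.
rewrite /Gp div1r -/u; split.
  have : (@lebesgue_measure R).-integrable D (fun x => K%:E * (q u x)%:E)%E.
    by apply: integrableZl.
  apply: eq_integrable => //.
  by move=> x /[!inE] Dx; rewrite kernelE// EFinM.
transitivity (\int[@lebesgue_measure R]_(x in D) (K%:E * (q u x)%:E))%E.
  by apply: eq_integral => x /[!inE] Dx; rewrite kernelE// EFinM.
rewrite integralZl// -int_q -EFinM -/K; congr (_%:E).
(* This single quantity is both the argument of [fZ] and the base of the squared factor in the
   target. *)
have uE : (1 + u)^-1 = theta * y / (1 + theta * y).
  rewrite /u; field.
  by rewrite !gt_eqF ?addr_gt0.
by rewrite -uE exprVn [RHS]mulrAC mulrA.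
Qed.
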